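(* Let $d\ge 1$ and let $E$ be a real $d\times d$ matrix all of whose eigenvalues have positive real parts. Let $\rho_1$ be an $(\mathbb{R}^d,E)$ pseudo-norm. Then a function $\rho_2:\mathbb{R}^d\to\mathbb{R}$ is an $(\mathbb{R}^d,E)$ pseudo-norm if and only if there exists a continuous function $g:\mathbb{R}^d\setminus\{0\}\to(0,\infty)$ such that $$\rho_2(\xi)=g\big(\rho_1(\xi)^{-E}\xi\big)\,\rho_1(\xi)\quad\text{for all }\xi\in\mathbb{R}^d\setminus\{0\},\qquad \rho_2(0)=0.$$
   Context: For $a>0$ and a real square matrix $M$, $a^{M}=\exp(M\log a)=\sum_{k\ge0}\frac{(\log a)^k M^k}{k!}$, and $a^{-M}=(a^{-1})^M$. Given a real $d\times d$ matrix $E$ whose eigenvalues all have positive real parts, a function $\rho:\mathbb{R}^d\to\mathbb{R}$ is called an $(\mathbb{R}^d,E)$ pseudo-norm if: (1) $\rho$ is continuous on $\mathbb{R}^d$; (2) $\rho$ is $E$-homogeneous, i.e. $\rho(a^E x)=a\rho(x)$ for all $x\in\mathbb{R}^d$ and all $a>0$; (3) $\rho(x)>0$ for all $x\in\mathbb{R}^d\setminus\{0\}$. (Homogeneity forces $\rho(0)=0$.) *)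

(* Defs.v *)
From HB Require Import structures.
From mathcomp Require Import all_boot all_order all_algebra.
From mathcomp Require Import complex.
From mathcomp Require Import all_classical all_reals all_analysis.
Import Order.TTheory GRing.Theory Num.Theory numFieldNormedType.Exports.

Set Implicit Arguments.
Unset Strict Implicit.
Unset Printing Implicit Defensive.

Local Open Scope classical_set_scope.
Local Open Scope ring_scope.

(* [lim] is a total operator; the exponential series converges for every M. *)
Definition mxexp (R : realType) (d : nat) (M : 'M[R]_d) : 'M[R]_d :=
  lim (series (fun k : nat => (k`!%:R)^-1 *: M ^+ k) @ \oo).

(* a^M; meaningful only for 0 < a, since [ln a = 0] for a <= 0. *)
Definition mxpow (R : realType) (d : nat) (a : R) (M : 'M[R]_d) : 'M[R]_d :=
  mxexp (ln a *: M).

(* The eigenvalues of a real matrix are its complex ones. [eigenvalue] is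
   defined through row eigenvectors; the spectrum is the same as for columns. *)
Definition eigenvalues_Re_gt0 (R : realType) (d : nat) (E : 'M[R]_d) : Prop :=
  forall z : R[i],
    eigenvalue (map_mx (real_complex R) E) z -> 0 < complex.Re z.

Definition pseudo_norm (R : realType) (d : nat) (E : 'M[R]_d)
    (rho : 'cV[R]_d -> R) : Prop :=
  [/\ continuous rho,
      (forall (x : 'cV[R]_d) (a : R), 0 < a ->
         rho (mxpow a E *m x) = a * rho x) &
      (forall x : 'cV[R]_d, x != 0 -> 0 < rho x)].

(* Main.v *)
(* If [rho2] is a pseudo-norm, homogeneity gives the factorization with [g = rho2].

   Conversely, [g (rho1^-E xi) * rho1 xi] is homogeneous by the group law
   [(a b)^E = a^E b^E], and continuous away from [0] because [a^E] is continuous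
   in [a]. For continuity at [0], choose [a] so large that on the unit sphere
   [rho1 (a^E x)] exceeds the maximum of [rho1] on the ball of radius 2; then
   [2 |x| <= |a^E x|] for all [x] by linearity. Hence every small nonzero [x] is
   carried by some power of [a^E] into a fixed compact annulus, where
   [rho2 / rho1] is bounded; this ratio is invariant under [a^E], so
   [rho2 <= K * rho1] near [0].

   The group law comes from differentiating [exp ((s + t - u) M) exp (u M)] in
   [u] entry by entry, each entry being a power series. *)
Require Import Defs.
From HB Require Import structures.
From mathcomp Require Import all_boot all_order all_algebra.
From mathcomp Require Import complex.
From mathcomp Require Import all_classical all_reals all_analysis.
From mathcomp Require Import ring lra.
Import Order.TTheory GRing.Theory Num.Theory numFieldNormedType.Exports.

Local Open Scope classical_set_scope.
Local Open Scope ring_scope.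

(** * Limits, norm bounds and compactness for matrices under the max norm *)

Section MatrixTopology.
Context {R : realType}.

Lemma cvg_mx {T : Type} (F : set_system T) {FF : Filter F} m n
    (f : T -> 'M[R]_(m, n)) (A : 'M[R]_(m, n)) :
  (forall i j, f x i j @[x --> F] --> A i j) -> f @ F --> A.
Proof.
move=> fA; apply/cvgrPdist_le => /= e e0; near=> x.
rewrite /Num.Def.normr/= mx_normrE (bigmax_le _ (ltW e0))//= => i _.
rewrite !mxE; move: i; near: x; apply: filter_forall => /= i.
exact: ((cvgrPdist_le _ _).1 (fA i.1 i.2)).
Unshelve. all: by end_near. Qed.

Lemma cvg_mulmx {T : Type} (F : set_system T) {FF : Filter F} m n p
    (f : T -> 'M[R]_(m, n)) (g : T -> 'M[R]_(n, p))
    (A : 'M[R]_(m, n)) (B : 'M[R]_(n, p)) :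
  f @ F --> A -> g @ F --> B -> f x *m g x @[x --> F] --> A *m B.
Proof.
move=> fA gB; apply: cvg_mx => i j; rewrite mxE.
under eq_fun do rewrite mxE.
apply: cvg_big => /= [|k _]; [exact: add_continuous|apply: cvgM].
- exact: (continuous_cvg _ (@coord_continuous _ m n i k A) fA).
- exact: (continuous_cvg _ (@coord_continuous _ n p k j B) gB).
Qed.

Lemma ler_coord_norm m n (A : 'M[R]_(m, n)) i j : `|A i j| <= `|A|.
Proof.
by rewrite [leRHS]/Num.Def.normr /= mx_normrE; exact: (le_bigmax _ _ (i, j)).
Qed.

(** The norm is the largest absolute entry and each entry of the product sums [n] terms, whence the
    factor [n]. *)
Lemma mulmx_norm_le {m n p} (A : 'M[R]_(m, n)) (B : 'M[R]_(n, p)) :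
  `|A *m B| <= n%:R * `|A| * `|B|.
Proof.
rewrite [leLHS]/Num.Def.normr /= mx_normrE bigmax_le ?mulr_ge0// => -[i j] _ /=.
rewrite mxE (le_trans (ler_norm_sum _ _ _))//.
have -> : n%:R * `|A| * `|B| = \sum_(k < n) `|A| * `|B|.
  by rewrite sumr_const card_ord -mulrA mulr_natl.
rewrite ler_sum// => k _.
by rewrite normrM ler_pM// ler_coord_norm.
Qed.

Lemma trmx_continuous m n : continuous (@trmx R m n).
Proof.
move=> A; apply: (@cvg_mx _ _ (nbhs_filter A)) => i j; rewrite mxE.
under eq_fun do rewrite mxE.
exact: coord_continuous.
Qed.

(** Transposition is continuous and preserves the max norm, so the claim transfers from row
    vectors. *)
Lemma bounded_closed_compact_cV n (A : set 'cV[R]_n) :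
  bounded_set A -> closed A -> compact A.
Proof.
move=> Ab Ac; have -> : A = trmx @` (trmx @^-1` A).
  apply/seteqP; split => [x Ax|_ [y Ay <-]]//.
  by exists x^T; rewrite /= trmxK.
apply: continuous_compact.
  by apply: continuous_subspaceT => x; exact: trmx_continuous.
apply: bounded_closed_compact.
  case: Ab => M [Mr MA]; exists M; split => // y My x /= /(MA _ My).
  congr (_ <= _); rewrite /Num.Def.normr /= !mx_normrE.
  apply/eqP; rewrite eq_le; apply/andP; split; apply: bigmax_le => [|[i j] _] /=;
    rewrite ?bigmax_ge_id// ?mxE; try exact: (le_bigmax _ _ (j, i)).
  by apply: (le_trans _ (le_bigmax _ _ (j, i))); rewrite /= mxE.
by apply: preimage_closed => //; move=> x _; exact: trmx_continuous.
Qed.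

End MatrixTopology.

(** * The one-parameter group [exp (t M)], entry by entry *)

Section MatrixExponential.
Variables (R : realType) (d : nat) (M : 'M[R]_d).

Definition mxexp_coeff i j (k : nat) : R := (k`!%:R)^-1 * (M ^+ k) i j.

(** This is [exp (t M)], written as a matrix of scalar power series in [t] so that termwise
    differentiation of real series applies. *)
Definition mxflow (t : R) : 'M[R]_d :=
  \matrix_(i, j) limn (pseries (mxexp_coeff i j) t).

Lemma mx_expr_coord_le k i j :
  `|(M ^+ k) i j| <= (\sum_i' \sum_j' `|M i' j'|) ^+ k.
Proof.
elim: k i j => [|k IH] i j.
  by rewrite !expr0 mxE; case: eqP => _; rewrite ?normr1 ?normr0 ?ler01.
rewrite exprS -mulmxE mxE (le_trans (ler_norm_sum _ _ _))//.
under eq_bigr do rewrite normrM.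
apply: (@le_trans _ _ (\sum_l `|M i l| * (\sum_i' \sum_j' `|M i' j'|) ^+ k)).
  by apply: ler_sum => l _; rewrite ler_wpM2l.
rewrite -mulr_suml exprS ler_wpM2r ?exprn_ge0 ?sumr_ge0//.
  by move=> *; rewrite sumr_ge0.
(* The absolute sum of row [i] is one term of the double sum. *)
by rewrite [leRHS](bigD1 i)//= lerDl sumr_ge0// => *; rewrite sumr_ge0.
Qed.

(** Comparison with [q ^+ p] times the exponential series at [q * |x|]. The shifts [p] = 0, 1, 2
    give the entry series and its first two formal derivatives. *)
Lemma is_cvg_mxexp_pseries p i j (x : R) :
  cvgn (pseries (fun k => (k`!%:R)^-1 * (M ^+ (k + p)) i j) x).
Proof.
set q := \sum_i' \sum_j' `|M i' j'|.
have q0 : 0 <= q by rewrite sumr_ge0// => *; rewrite sumr_ge0.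
have vE k : (q ^+ p *: exp_coeff (q * `|x|)) k =
    q ^+ p * ((q * `|x|) ^+ k / k`!%:R) by [].
apply: normed_cvg; rewrite /normed_series_of /=.
apply: (@series_le_cvg _ _ (q ^+ p *: exp_coeff (q * `|x|))) => [k|k|k|].
- exact: normr_ge0.
- by rewrite vE mulr_ge0 ?divr_ge0 ?exprn_ge0 ?mulr_ge0.
- rewrite vE /= !normrM normfV normr_nat normrX.
  rewrite [leRHS](_ : _ = (k`!%:R)^-1 * q ^+ (k + p) * `|x| ^+ k).
    by rewrite ler_wpM2r ?exprn_ge0// ler_wpM2l ?invr_ge0// mx_expr_coord_le.
  by rewrite exprMn exprD; ring.
- exact/is_cvg_seriesZ/is_cvg_series_exp_coeff.
Qed.

(** Since (k+1)/(k+1)! = 1/k!, formal differentiation of an exponential-type series only shifts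
    [c]. *)
Lemma pseries_diffs_factV (c : R^nat) :
  pseries_diffs (fun k => (k`!%:R)^-1 * c k) = fun k => (k`!%:R)^-1 * c k.+1.
Proof.
by apply/funext => k; rewrite /pseries_diffs factS natrM invfM mulrA mulVKf.
Qed.

Lemma cvg_mxflow_series t i j : pseries (mxexp_coeff i j) t @ \oo --> mxflow t i j.
Proof.
rewrite mxE; have := is_cvg_mxexp_pseries 0 i j t.
by under eq_fun do rewrite addn0.
Qed.

Lemma mx_exprZn (t : R) k : (t *: M) ^+ k = t ^+ k *: M ^+ k.
Proof.
elim: k => [|k IH]; first by rewrite !expr0 scale1r.
by rewrite !exprS IH -!mulmxE -scalemxAl -scalemxAr scalerA.
Qed.

Lemma mxexp_mxflow t : mxexp (t *: M) = mxflow t.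
Proof.
apply/cvg_lim => //; apply: cvg_mx => i j.
rewrite [X in X @ _ --> _](_ : _ = pseries (mxexp_coeff i j) t).
  exact: cvg_mxflow_series.
apply/funext => n; rewrite /series /pseries /= summxE; apply: eq_bigr => k _.
by rewrite mx_exprZn !mxE /mxexp_coeff; ring.
Qed.

Lemma mxflow0 : mxflow 0 = 1.
Proof.
apply/matrixP => i j; rewrite mxE.
apply: lim_near_cst => //; near=> n.
(* The empty partial sum is 0, so the sums are constant only from index 1 on. *)
rewrite -[n]prednK; last by near: n.
rewrite /pseries /series /= big_nat_recl//= big1 ?addr0.
  by rewrite expr0 mulr1 /mxexp_coeff expr0 fact0 invr1 mul1r.
by move=> k _; rewrite expr0n mulr0.
Unshelve. all: by end_near. Qed.

Lemma is_derive_mxflow_series t i j :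
  is_derive t (1 : R) (fun s => mxflow s i j)
    (limn (pseries (fun k => (k`!%:R)^-1 * (M ^+ k.+1) i j) t)).
Proof.
have -> : (fun s => mxflow s i j) = fun s => limn (pseries (mxexp_coeff i j) s).
  by apply/funext => s; rewrite mxE.
rewrite -(pseries_diffs_factV (fun k => (M ^+ k) i j)).
(* Termwise differentiation needs convergence at some point of modulus larger than [|t|]. *)
apply: (@pseries_snd_diffs _ _ (`|t| + 1)).
- by have := is_cvg_mxexp_pseries 0 i j (`|t| + 1); under eq_fun do rewrite addn0.
- rewrite pseries_diffs_factV.
  by have := is_cvg_mxexp_pseries 1 i j (`|t| + 1); under eq_fun do rewrite addn1.
- rewrite !pseries_diffs_factV.
  by have := is_cvg_mxexp_pseries 2 i j (`|t| + 1); under eq_fun do rewrite addn2.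
- by rewrite [ltRHS]ger0_norm ?addr_ge0// ltrDl.
Qed.

Lemma is_derive_mxflow t i j :
  is_derive t (1 : R) (fun s => mxflow s i j) ((M *m mxflow t) i j).
Proof.
apply: is_derive_eq (is_derive_mxflow_series t i j) _.
apply/cvg_lim => //.
rewrite mxE.
have -> : pseries (fun k => (k`!%:R)^-1 * (M ^+ k.+1) i j) t =
    (fun n => \sum_l M i l * pseries (mxexp_coeff l j) t n).
  apply/funext => n; rewrite {1}/pseries {1}/series /=.
  under [RHS]eq_bigr do rewrite /pseries /series /= mulr_sumr.
  rewrite exchange_big; apply: eq_bigr => k _.
  rewrite exprS -mulmxE mxE mulr_sumr mulr_suml; apply: eq_bigr => l _.
  by rewrite /mxexp_coeff; ring.
apply: cvg_big => [|l _]; first exact: add_continuous.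
by apply: cvgM; [exact: cvg_cst|exact: cvg_mxflow_series].
Qed.

(** Both products have the same partial sums, because [M] commutes with its powers. *)
Lemma mxflow_comm t : M *m mxflow t = mxflow t *m M.
Proof.
apply/matrixP => i j; rewrite !mxE.
have cl : (fun n => \sum_l M i l * pseries (mxexp_coeff l j) t n) @ \oo -->
   \sum_l M i l * mxflow t l j.
  apply: cvg_big => [|l _]; first exact: add_continuous.
  by apply: cvgM; [exact: cvg_cst|exact: cvg_mxflow_series].
have cr : (fun n => \sum_l pseries (mxexp_coeff i l) t n * M l j) @ \oo -->
   \sum_l mxflow t i l * M l j.
  apply: cvg_big => [|l _]; first exact: add_continuous.
  by apply: cvgM; [exact: cvg_mxflow_series|exact: cvg_cst].
suff clr : (fun n => \sum_l M i l * pseries (mxexp_coeff l j) t n) =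
    (fun n => \sum_l pseries (mxexp_coeff i l) t n * M l j).
  by rewrite clr in cl; exact: (cvg_unique _ cl cr).
apply/funext => n; under eq_bigr do rewrite /pseries /series /= mulr_sumr.
under [RHS]eq_bigr do rewrite /pseries /series /= mulr_suml.
rewrite exchange_big [RHS]exchange_big; apply: eq_bigr => k _ /=.
transitivity ((k`!%:R)^-1 * t ^+ k * (M ^+ k.+1) i j).
  rewrite exprS -mulmxE mxE mulr_sumr; apply: eq_bigr => l _.
  by rewrite /mxexp_coeff; ring.
rewrite exprSr -mulmxE mxE mulr_sumr; apply: eq_bigr => l _.
by rewrite /mxexp_coeff; ring.
Qed.

Lemma mxflowD s t : mxflow (s + t) = mxflow s *m mxflow t.
Proof.
(* Compare the endpoints [u = 0] and [u = t] of a function of [u] with zero derivative. *)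
have cstE i j : (mxflow (s + t - 0) *m mxflow 0) i j =
                (mxflow (s + t - t) *m mxflow t) i j.
  apply: (@is_derive_0_is_cst _
    (fun u => (mxflow (s + t - u) *m mxflow u) i j)) => u.
  have -> : (fun u => (mxflow (s + t - u) *m mxflow u) i j) =
      \sum_l ((fun v => mxflow v i l) \o (fun u => s + t - u)) *
             (fun u => mxflow u l j).
    by apply/funext => v; rewrite mxE fct_sumE.
  (* Zero is put in the shape the product rule yields; both halves sum to the entry of [P], by
     [mxflow_comm]. *)
  have -> : 0 = \sum_l (mxflow (s + t - u) i l * (M *m mxflow u) l j
                - mxflow u l j * (M *m mxflow (s + t - u)) i l).
    pose P := mxflow (s + t - u) *m (M *m mxflow u).
    have e1 : \sum_l mxflow (s + t - u) i l * (M *m mxflow u) l j = P i j.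
      by rewrite mxE.
    have e2 : \sum_l mxflow u l j * (M *m mxflow (s + t - u)) i l = P i j.
      by rewrite /P mulmxA -mxflow_comm mxE; apply: eq_bigr => l _; rewrite mulrC.
    by rewrite sumrB e1 e2 subrr.
  apply: is_derive_sum => l.
  have dc : is_derive u (1 : R) ((fun v => mxflow v i l) \o (fun u => s + t - u))
     ((M *m mxflow (s + t - u)) i l * (- 1)).
    apply: is_derive1_comp; first exact: is_derive_mxflow.
    by rewrite -[X in is_derive _ _ _ X]sub0r; apply: is_deriveB.
  apply: is_derive_eq (is_deriveM dc (is_derive_mxflow u l j)) _.
  by rewrite /GRing.scale /=; ring.
apply/matrixP => i j; have := cstE i j.
by rewrite subr0 mxflow0 addrK -[1]/(1%:M) mulmx1.
Qed.

Lemma mxflow_continuous : continuous mxflow.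
Proof.
move=> t; apply: cvg_mx => i j.
have [/derivable1_diffP/differentiable_continuous + _] := is_derive_mxflow t i j.
exact.
Qed.

End MatrixExponential.

(** * Group law and continuity of [a^E] in [a] *)

Section MatrixPower.
Variables (R : realType) (d : nat) (E : 'M[R]_d).

Lemma mxpowM (a b : R) : 0 < a -> 0 < b ->
  mxpow (a * b) E = mxpow a E *m mxpow b E.
Proof. by move=> a0 b0; rewrite /mxpow lnM// !mxexp_mxflow mxflowD. Qed.

Lemma mxpow_continuous (a : R) :
  0 < a -> {for a, continuous (fun b => mxpow b E)}.
Proof.
move=> a0; have -> : (fun b => mxpow b E) = mxflow _ _ E \o @ln R.
  by apply/funext => b; rewrite /mxpow mxexp_mxflow.
by apply: continuous_comp; [exact: continuous_ln|exact: mxflow_continuous].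
Qed.

End MatrixPower.

(** Isolated from [pseudo_norm] so that it can be assumed of a function not yet known to be
    continuous at 0. *)
Definition homogeneous (R : realType) (d : nat) (E : 'M[R]_d)
    (rho : 'cV[R]_d -> R) :=
  forall (x : 'cV[R]_d) (a : R), 0 < a -> rho (mxpow a E *m x) = a * rho x.
Arguments homogeneous {R d}.

(** * Expansion by [a^E] and domination of homogeneous functions *)

Section PseudoNorm.
Context {R : realType} {d : nat} {E : 'M[R]_d}.
Implicit Types (rho : 'cV[R]_d -> R) (x : 'cV[R]_d).

Lemma homogeneous0 {rho} : homogeneous E rho -> rho 0 = 0.
Proof.
by move=> h; have := h 0 2 (ltr0n _ 2); rewrite mulmx0 => e; lra.
Qed.

Lemma homogeneous_iter {rho} (a : R) k x : homogeneous E rho -> 0 < a ->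
  rho (iter k (mulmx (mxpow a E)) x) = a ^+ k * rho x.
Proof.
move=> h a0; elim: k => [|k IH]; first by rewrite expr0 mul1r.
by rewrite iterS h// IH exprS mulrA.
Qed.

Lemma compact_annulus (r s : R) : compact [set x : 'cV[R]_d | r <= `|x| <= s].
Proof.
apply: bounded_closed_compact_cV.
  exists s; split; first exact: num_real.
  by move=> t st x /= /andP[_ xs]; exact: le_trans xs (ltW st).
have -> : [set x : 'cV[R]_d | r <= `|x| <= s] =
    [set x | r <= `|x|] `&` [set x | `|x| <= s].
  by apply/seteqP; split => x /=; [move/andP|move=> h; apply/andP].
by apply: closedI; [apply: (preimage_closed _ (@closed_ge _ r))|
  apply: (preimage_closed _ (@closed_le _ s))] => x _; exact: norm_continuous.
Qed.

Lemma unit_sphere_neq0 : (0 < d)%N -> exists x : 'cV[R]_d, `|x| = 1.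
Proof.
move=> d0; pose y : 'cV[R]_d := const_mx 1.
have y0 : `|y| != 0.
  rewrite normr_eq0; apply/eqP => /matrixP /(_ (Ordinal d0) ord0)/eqP.
  by rewrite !mxE oner_eq0.
by exists (`|y|^-1 *: y); rewrite normrZ normfV normr_id mulVf.
Qed.

Lemma pseudo_norm_expanding {rho} : (0 < d)%N -> pseudo_norm E rho ->
  exists2 a : R, 0 < a & forall x, 2 * `|x| <= `|mxpow a E *m x|.
Proof.
move=> d0 [rc rh rp].
have [e e1] := unit_sphere_neq0 d0.
(* The degenerate annuli are the unit sphere and the closed ball of radius 2. *)
have Sc := compact_annulus 1 1; have Bc := compact_annulus 0 2.
have ew (A : set 'cV[R]_d) : {within A, continuous rho}.
  exact: continuous_subspaceT.
have [|m mS mP] := compact_EVT_min _ Sc (ew _).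
  by exists e; rewrite /= e1 lexx.
have [|M MB MP] := compact_EVT_max _ Bc (ew _).
  by exists e; rewrite /= e1; lra.
have m0 : 0 < rho m.
  apply: rp; rewrite -normr_gt0; move: mS; rewrite inE /= => /andP[m1 _].
  exact: lt_le_trans m1.
have M0 : 0 <= rho M.
  rewrite -(homogeneous0 rh); apply: MP; rewrite inE /= normr0; lra.
have a0 : 0 < (rho M + 1) / rho m by apply: divr_gt0 => //; lra.
(* With this [a], [rho (a^E y)] is at least [rho M + 1] on the unit sphere, so [a^E y] cannot lie in
   the ball of radius 2. *)
exists ((rho M + 1) / rho m) => // x.
have [->|x0] := eqVneq x 0; first by rewrite mulmx0 !normr0 mulr0.
have nx : 0 < `|x| by rewrite normr_gt0.
rewrite leNgt; apply/negP => lt2.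
pose y := `|x|^-1 *: x.
have y1 : `|y| = 1 by rewrite normrZ normfV normr_id mulVf ?normr_eq0.
have y2 : `|mxpow ((rho M + 1) / rho m) E *m y| <= 2.
  rewrite -scalemxAr normrZ normfV normr_id mulrC ler_pdivrMr//.
  exact: ltW.
have := MP (mxpow ((rho M + 1) / rho m) E *m y).
rewrite inE /= normr_ge0 y2 => /(_ isT); rewrite rh//.
have : rho m <= rho y by apply: mP; rewrite inE /= y1 lexx.
move=> my.
have : rho M + 1 <= (rho M + 1) / rho m * rho y.
  rewrite -[leLHS](divfK (lt0r_neq0 m0)) ler_pM2l//.
lra.
Qed.

(** Take the first iterate of norm at least 1: its predecessor has norm below 1, and one application
    of [A] multiplies the norm by at most [d * |A|]. *)
Lemma expanding_reaches_annulus (A : 'M[R]_d) x :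
  (forall y : 'cV[R]_d, 2 * `|y| <= `|A *m y|) -> 0 < `|x| < 1 ->
  exists k, 1 <= `|iter k (mulmx A) x| <= d%:R * `|A|.
Proof.
move=> hA /andP[x0 x1].
have grow k : 2 ^+ k * `|x| <= `|iter k (mulmx A) x|.
  elim: k => [|k IH]; first by rewrite expr0 mul1r.
  rewrite iterS (le_trans _ (hA _))// exprS -mulrA.
  by rewrite ler_pM2l.
have ex : exists k, 1 <= `|iter k (mulmx A) x|.
  (* For this [k], 1/|x| < k <= 2^k. *)
  exists (Num.truncn `|x|^-1).+1; apply: le_trans (grow _).
  rewrite -ler_pdivrMr// div1r.
  have /ltW/le_trans := truncnS_gt `|x|^-1; apply.
  by rewrite -natrX ler_nat ltnW// ltn_expl.
have [[|k] k1 kmin] := ex_minnP ex; first by move: k1 => /=; lra.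
exists k.+1; rewrite k1 /= (le_trans (mulmx_norm_le _ _))//.
rewrite ler_piMr ?mulr_ge0// ltW// ltNge; apply/negP => /kmin.
by rewrite ltnn.
Qed.

(** The ratio [f] is constant along the iterates of [a^E], so its bound on the annulus holds at
    every nonzero point of the open unit ball. *)
Lemma homogeneous_dominated {rho sigma} : (0 < d)%N -> pseudo_norm E rho ->
  homogeneous E sigma -> (forall x, x != 0 -> {for x, continuous sigma}) ->
  exists K : R, forall x, `|x| < 1 -> `|sigma x| <= K * rho x.
Proof.
move=> d0 rhoP hs cs; have [rc rh rp] := rhoP.
have [a a0 ha] := pseudo_norm_expanding d0 rhoP.
set Am := mxpow a E in ha.
pose f x := `|sigma x| / rho x.
have Ac := compact_annulus 1 (d%:R * `|Am|).
have fc : {within [set x : 'cV[R]_d | 1 <= `|x| <= d%:R * `|Am|], continuous f}.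
  apply: continuous_in_subspaceT => x; rewrite inE /= => /andP[x1 _].
  have x0 : x != 0 by rewrite -normr_gt0; exact: lt_le_trans x1.
  have nc : {for x, continuous (fun y => `|sigma y|)}.
    by apply: (@continuous_comp _ _ _ sigma); [exact: cs|exact: norm_continuous].
  have ic : {for x, continuous (fun y => (rho y)^-1)}.
    exact: (cvgV (lt0r_neq0 (rp _ x0)) (rc x)).
  exact: (cvgM nc ic).
have [K KP] : exists K, forall x, 1 <= `|x| <= d%:R * `|Am| -> f x <= K.
  (* The extreme value theorem needs a nonempty set; on an empty annulus any constant serves. *)
  have [[y yA]|nA] := pselect ([set x : 'cV[R]_d | 1 <= `|x| <= d%:R * `|Am|] !=set0).
    have [//|c _ cP] := compact_EVT_max _ Ac fc; first by exists y.
    by exists (f c) => x xA; apply: cP; rewrite inE.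
  by exists 0 => x xA; exfalso; apply: nA; exists x.
exists K => x x1; have [->|x0] := eqVneq x 0.
  by rewrite (homogeneous0 hs) (homogeneous0 rh) normr0 mulr0.
have [|k kA] := expanding_reaches_annulus Am x ha.
  by rewrite normr_gt0 x0.
have ak : 0 < a ^+ k by rewrite exprn_gt0.
have := KP _ kA; rewrite /f !homogeneous_iter// normrM (gtr0_norm ak).
by rewrite -mulf_div divff ?gt_eqF// mul1r ler_pdivrMr ?rp.
Qed.

End PseudoNorm.

(** * The characterization of pseudo-norms *)

Theorem theorem3p2 (R : realType) (d : nat) (hd : (0 < d)%N) (E : 'M[R]_d)
    (hE : eigenvalues_Re_gt0 E) (rho1 : 'cV[R]_d -> R)
    (hrho1 : pseudo_norm E rho1) (rho2 : 'cV[R]_d -> R) :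
  pseudo_norm E rho2 <->
  exists g : 'cV[R]_d -> R,
    [/\ {within [set x : 'cV[R]_d | x != 0], continuous g},
        (forall x : 'cV[R]_d, x != 0 -> 0 < g x),
        (forall xi : 'cV[R]_d, xi != 0 ->
           rho2 xi = g (mxpow (rho1 xi)^-1 E *m xi) * rho1 xi) &
        rho2 0 = 0].
Proof.
have [c1 h1 p1] := hrho1; split.
  move=> [c2 h2 p2]; exists rho2; split => //; first exact: continuous_subspaceT.
    move=> x x0; rewrite h2 ?invr_gt0 ?p1// mulrC mulVKf//.
    by rewrite gt_eqF ?p1.
  exact: homogeneous0 h2.
move=> [g [cg pg e2 e0]].
have r10 : rho1 0 = 0 by exact: homogeneous0 h1.
(* Otherwise homogeneity would give [a * rho1 x = rho1 0 = 0]. *)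
have neq0 (x : 'cV[R]_d) (a : R) : 0 < a -> x != 0 -> mxpow a E *m x != 0.
  move=> a0 x0; apply/eqP => ax0; have /esym/eqP := h1 x a a0.
  by rewrite ax0 r10 mulf_eq0 !gt_eqF ?p1.
have p2 (x : 'cV[R]_d) : x != 0 -> 0 < rho2 x.
  by move=> x0; rewrite e2// mulr_gt0 ?p1// pg// neq0// invr_gt0 p1.
have h2 : homogeneous E rho2.
  move=> x a a0; have [->|x0] := eqVneq x 0; first by rewrite mulmx0 e0 mulr0.
  (* The argument of [g] is unchanged: the exponent bases multiply to
     [(a * rho1 x)^-1 * a = (rho1 x)^-1]. *)
  rewrite !e2 ?neq0// h1// mulmxA -mxpowM ?invr_gt0 ?mulr_gt0 ?p1//.
  by rewrite invfM mulrAC mulVf ?gt_eqF// mul1r; ring.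
have c2 (x : 'cV[R]_d) : x != 0 -> {for x, continuous rho2}.
  move=> x0.
  have opn : open [set y : 'cV[R]_d | y != 0].
    rewrite (_ : [set y | _] = ~` [set 0]).
      exact/closed_openC/accessible_closed_set1/hausdorff_accessible/norm_hausdorff.
    by apply/seteqP; split => y /=; move/eqP.
  have near0 : \forall y \near x, y != 0 by exact: open_nbhs_nbhs.
  pose F (y : 'cV[R]_d) := g (mxpow (rho1 y)^-1 E *m y) * rho1 y.
  have Fc : {for x, continuous F}.
    pose G (y : 'cV[R]_d) := mxpow (rho1 y)^-1 E *m y.
    have pc : {for x, continuous (fun y => mxpow (rho1 y)^-1 E)}.
      apply: (@continuous_comp _ _ _ (fun y => (rho1 y)^-1) (fun b => mxpow b E)).
        exact: (cvgV (lt0r_neq0 (p1 _ x0)) (c1 x)).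
      by apply: mxpow_continuous; rewrite invr_gt0 p1.
    have Gc : {for x, continuous G}.
      exact: (@cvg_mulmx R _ (nbhs x) (nbhs_filter x) d d 1
        (fun y => mxpow (rho1 y)^-1 E) id _ x pc cvg_id).
    have gG : {for x, continuous (g \o G)}.
      apply: continuous_comp => //.
      (* On the open punctured space, continuity within the subspace is continuity at each point. *)
      move: cg; rewrite continuous_open_subspace// => /(_ (G x)); apply.
      by rewrite inE /= neq0// invr_gt0 p1.
    exact: (cvgM gG (c1 x)).
  (* [rho2] is known to equal [F] only off 0, hence throughout a neighbourhood of [x]. *)
  rewrite /prop_for /continuous_at e2//; move: Fc.
  rewrite /prop_for /continuous_at; apply: cvg_trans.
  by apply: (@near_eq_cvg _ _ _ (nbhs_filter x)); apply: filterS near0 => y /e2 ->.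
have [K KP] := homogeneous_dominated hd hrho1 h2 c2.
split => // x; have [->|x0] := eqVneq x 0; last exact: c2.
(* At 0, [rho2] is squeezed between [- (K * rho1)] and [K * rho1], both tending to 0. *)
have Kc : K * rho1 y @[y --> (0 : 'cV[R]_d)] --> 0.
  rewrite -[X in _ --> X](mulr0 K) -r10.
  have Kcst : {for (0 : 'cV[R]_d), continuous (fun=> K)} by exact: cst_continuous.
  exact: (cvgM Kcst (c1 0)).
have sq : \forall y \near (0 : 'cV[R]_d), - (K * rho1 y) <= rho2 y <= K * rho1 y.
  by apply: filterS (nbhs0_lt ltr01) => y /KP; rewrite ler_norml.
rewrite /continuous_at e0.
apply: (@squeeze_cvgr _ _ (nbhs_filter (0 : 'cV[R]_d)) _ _ _ _ sq _ _ Kc).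
by rewrite -[X in _ --> X]oppr0; exact: (cvgN Kc).
Qed.
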